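(* For infinitely many natural numbers $n$, there exists a connected vertex-transitive digraph $D$ on $n$ vertices whose perimeter gap is at least $n/12$.
   Context: All digraphs are finite; as usual they have no loops or parallel arcs, but a pair of opposite arcs is allowed (and then forms a directed cycle of length $2$). A digraph $D$ is vertex-transitive if for every pair of vertices $u,v\in V(D)$ there is an automorphism of $D$ mapping $u$ to $v$. A digraph is connected if its underlying undirected graph is connected (for finite vertex-transitive digraphs this is equivalent to strong connectivity). Directed cycles do not repeat vertices, and the length of a directed cycle is its number of arcs. The perimeter gap of a digraph is the difference between its number of vertices and the length of its longest directed cycle. *)

(* Defs.v *)
From mathcomp Require Import all_boot perm.

Set Implicit Arguments.
Unset Strict Implicit.
Unset Printing Implicit Defensive.

Record digraph := Digraph {
  vertex : finType;
  is_arc : rel vertex;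
  is_arc_irrefl : irreflexive is_arc
}.

Section DigraphTheory.
Variable D : digraph.

Definition is_automorphism (f : {perm vertex D}) : bool :=
  [forall u, forall v, is_arc (f u) (f v) == is_arc u v].

Definition vertex_transitive : Prop :=
  forall u v : vertex D,
    exists2 f : {perm vertex D}, is_automorphism f & f u = v.

Definition underlying_adj : rel (vertex D) :=
  [rel u v | is_arc u v || is_arc v u].

Definition connected_digraph : Prop :=
  forall u v : vertex D, connect underlying_adj u v.

(* The bound on the size excludes only [::], which [path.cycle] accepts: there are
   no loops, so no sequence of size 1 is a cycle. *)
Definition directed_cycle (c : seq (vertex D)) : bool :=
  [&& 1 < size c, path.cycle (@is_arc D) c & uniq c].

(* A directed cycle has at most #|vertex D| arcs, so k ranges over all possible
   lengths. The value is 0 if D has no directed cycle. *)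
Definition longest_cycle_length : nat :=
  \max_(k < #|vertex D|.+1 | [exists c : k.-tuple (vertex D), directed_cycle c])
    k.

(* The subtraction never truncates, as longest_cycle_length <= #|vertex D|. *)
Definition perimeter_gap : nat := #|vertex D| - longest_cycle_length.

End DigraphTheory.

(* Main.v *)
Require Import Defs.
From mathcomp Require Import all_boot all_order all_algebra all_fingroup.
From mathcomp Require Import zify ring.

Set Implicit Arguments.
Unset Strict Implicit.
Unset Printing Implicit Defensive.

(** Let G be a finite group generated by [a] and [b] with
    [a ^+ 3 = b ^+ 2 = (a * a * b) ^+ 6 = 1], and let D be its Cayley digraph.
    The cosets of [<[a]>] are directed triangles, joined in pairs by the
    2-cycles x, xb; contracting the triangles gives a cubic graph H drawn on a
    surface with (possibly degenerate) hexagonal faces.  A directed cycle of D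
    of length above 3 follows a cycle of H: it enters a triangle at some x along
    a b-arc, and then either turns left, passing through x and xa only and
    leaving to xab, or turns right, passing through all of x, xa, xaa and
    leaving to xaab.

    A left turn misses the vertex xaa, so it suffices to show that left turns
    are frequent.  The faces being hexagons, a long cycle never makes five right
    turns in a row: the edges met on the way would be all the edges of a face.
    Four right turns in a row, preceded and followed by a left turn, go around a
    hexagon except for one edge; this run cannot come just after three right
    turns and a left turn, which would go around the neighbouring hexagon across
    that edge: the cycle would close up around the union of both.  Hence runs
    of four are compensated by runs of at most two, and there are at most three
    times as many right turns as left turns ([card_rights_le]).

    With L left and R right turns the cycle has 2L + 3R <= 11L vertices and
    misses at least L vertices, so it misses at least a twelfth of D
    ([long_cycle_size]).  Arbitrarily large groups of this kind are generated by
    a rotation of order three and a rotation of order two of the torus Z/m x Z/m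
    ([rotation_group_exists]). *)

(** * Words without long runs *)

Section Itinerary.
(* The orbits of [f] on [E] are read as cyclic words; the letter at [x] says
   whether [R x] holds. *)
Variables (T : finType) (E : {set T}) (f : T -> T) (R : pred T).

Definition itinerary n x := [seq R (iter i f x) | i <- iota 0 n].

(** The number of consecutive letters [R] from [x] on, truncated at [n]. *)
Fixpoint run n x :=
  if n is m.+1 then if R x then (run m (f x)).+1 else 0 else 0.

(** A potential function: the excess of letters [R] over three times the other
    letters that can still accumulate from [x] on.  It is the length of the
    current run, plus one if the next run has length four: that next run will
    exceed by one the three letters [R] which the letter before it pays for, so
    its first letter is charged to the previous non-[R] letter, the run in
    between being short. *)
Definition debt x := run 5 x + (run 5 (iter (run 5 x).+1 f x) == 4).

Hypothesis fE : {in E, forall x, f x \in E}.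
Hypothesis f_inj : {in E &, injective f}.
Hypothesis no_R5 : {in E, forall x, itinerary 5 x != nseq 5 true}.
Hypothesis no_R3LR4 : {in E, forall x,
  itinerary 8 x != nseq 3 true ++ false :: nseq 4 true}.

Lemma debt_step x : x \in E -> R x + debt (f x) <= 3 * ~~ R x + debt x.
Proof.
move=> Ex; have Ey := fE Ex; have Efy := fE Ey.
have := no_R5 Ex; have := no_R5 Ey; have := no_R3LR4 Ey; have := no_R3LR4 Efy.
rewrite /debt /itinerary /=; case: (R x) => /=; set y := f x.
(* Inside a run the debt decreases by exactly one. *)
  by repeat (case: (R _) => //=).
(* After a non-R letter, the next run starts at y; a run of length at most two
   leaves room for the unit that pays for a subsequent run of length four, and
   a longer run cannot be followed by one. *)
case: (R y) => /=; last by case: (_ == 4).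
case: (R (f y)) => /=; last by case: (_ == 4).
case: (R (f (f y))) => /=; last by case: (_ == 4).
case: (R (f (f (f y)))) => /=; first case: (R (f (f (f (f y))))) => //=.
  by repeat (case: (R _) => //=).
by repeat (case: (R _) => //=).
Qed.

Lemma sum_f_in (F : T -> nat) : \sum_(x in E) F (f x) = \sum_(x in E) F x.
Proof.
suff {2}<-: f @: E = E by rewrite big_imset.
apply/eqP; rewrite eqEcard card_in_imset // leqnn andbT.
by apply/subsetP=> _ /imsetP[y Ey ->]; exact: fE.
Qed.

Lemma card_rights_le : #|[set x in E | R x]| <= 3 * #|[set x in E | ~~ R x]|.
Proof.
(* Summing [debt_step] over E, the debts cancel since f permutes E. *)
have: \sum_(x in E) (R x + debt (f x)) <= \sum_(x in E) (3 * ~~ R x + debt x).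
  by apply: leq_sum => x; exact: debt_step.
rewrite [leqLHS]big_split [leqRHS]big_split /= (sum_f_in debt) leq_add2r.
rewrite -big_distrr /=.
have card_sum (P : pred T) : \sum_(x in E) (P x : nat) = #|[set x in E | P x]|.
  rewrite cardsE -sum1_card big_mkcondr /=.
  by apply: eq_bigr => x _; case: (P x).
by rewrite card_sum (card_sum (predC R)).
Qed.

End Itinerary.

(** * Turns of a long directed cycle *)

Definition cayley_arc (gT : finGroupType) (a b : gT) : rel gT :=
  [rel x y | (y == x * a)%g || (y == x * b)%g].

Section LongCycle.
Variables (gT : finGroupType) (a b : gT).
Hypothesis a_neq1 : a != 1%g.
Hypotheses (a3 : (a ^+ 3 = 1)%g) (b2 : (b ^+ 2 = 1)%g).
Hypothesis (r6 : ((a * a * b) ^+ 6 = 1)%g).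
Open Scope group_scope.

Lemma a_neq_b : a != b.
Proof.
by apply: contraNneq a_neq1 => ab; rewrite -a3 expgS ab b2 mulg1.
Qed.

Lemma mulaaa x : x * a * a * a = x.
Proof. by rewrite -!mulgA -[a * (a * a)]/(a ^+ 3) a3 mulg1. Qed.

Lemma mulbb x : x * b * b = x.
Proof. by rewrite -mulgA -[b * b]/(b ^+ 2) b2 mulg1. Qed.

Lemma a2_neq_b : a * a != b.
Proof.
apply: contraNneq a_neq1 => aa_b.
by rewrite -[a]mulaaa -[X in X == _]mulgA aa_b -[1](mulbb 1) mul1g.
Qed.

Lemma mul_r6 x : iter 6 (fun y => y * a * a * b) x = x.
Proof.
have: x * (a * a * b) ^+ 6 = x by rewrite r6 mulg1.
by rewrite !expgS expg0 mulg1 !mulgA.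
Qed.

(** Going around the union of two adjacent hexagonal faces makes ten turns, of
    which two, at opposite ends of the common edge, are left turns. *)
Lemma mul_r3lr4lr x : let r y := y * a * a * b in
  r (iter 4 r (iter 3 r x * a * b) * a * b) = x.
Proof.
move=> r.
have ri y : r (y * b * a) = y by rewrite /r mulaaa mulbb.
have r6K y : iter 6 r y = y by exact: mul_r6.
have r4 y : iter 4 r y = y * b * a * b * a.
  by rewrite -[RHS]r6K (iterD 4 2) [iter 2 _ _]/= !ri.
have r3 y : iter 3 r y = y * b * a * b * a * b * a.
  by rewrite -[RHS]r6K (iterD 3 3) [X in _ = iter 3 r X]/= !ri.
by rewrite r4 r3 /r !(mulaaa, mulbb).
Qed.

Variable c : seq gT.
Hypotheses (c_cycle : path.cycle (cayley_arc a b) c) (c_uniq : uniq c).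
(* The longest closed walk to be excluded makes ten turns, each of which passes
   through at most three vertices. *)
Hypothesis c_long : 30 < size c.
Local Notation s := (next c).

Lemma next_injective : injective s.
Proof. exact: can_inj (prev_next c_uniq). Qed.

Lemma next_is_arc x : x \in c -> s x = x * a \/ s x = x * b.
Proof.
by move=> cx; case/orP: (next_cycle c_cycle cx) => /eqP->; [left | right].
Qed.

Lemma next_aperiodic k x : x \in c -> 0 < k <= 30 -> iter k s x <> x.
Proof.
move=> cx /andP[k_gt0 k_le] /(congr1 (findex s x)).
rewrite findex_iter ?findex0; first by move=> k0; rewrite k0 in k_gt0.
by rewrite (order_cycle (cycle_next c_uniq) c_uniq cx) (leq_ltn_trans k_le).
Qed.

(** The vertices at which the cycle enters a triangle, that is, those it reaches
    along a b-arc. *)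
Definition entries := [set x | (x * b \in c) && (s (x * b) == x)].
Local Notation E := entries.

Lemma entryP x : x \in E ->
  [/\ x \in c, x * b \in c, s (x * b) = x & s x = x * a].
Proof.
rewrite inE => /andP[cxb /eqP sxb].
have cx : x \in c by rewrite -sxb mem_next.
split=> //; case: (next_is_arc cx) => // sx.
by case: (@next_aperiodic 2 x cx isT); rewrite /= sx.
Qed.

Lemma b_arc_entry x : x \in c -> s x = x * b -> x * b \in E.
Proof. by move=> cx sx; rewrite inE mulbb cx sx eqxx. Qed.

Lemma next_at_left_turn x : x * a * b \in E -> s (x * a) = x * a * b.
Proof. by move=> /entryP[_ _]; rewrite mulbb. Qed.

(** A visit to a triangle passes through two or three of its vertices: leaving
    at once would run back along the 2-cycle just used, and following three arcs
    of the triangle would close it. *)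
Lemma entry_turn x : x \in E ->
  (x * a * b \in E /\ s (x * a) = x * a * b) \/
  [/\ x * a * b \notin E, x * a * a * b \in E, s (x * a) = x * a * a
    & s (x * a * a) = x * a * a * b].
Proof.
move=> Ex; have [cx _ sxb sx] := entryP Ex.
have cxa : x * a \in c by rewrite -sx mem_next.
case: (boolP (x * a * b \in E)) => [El | nEl].
  by left; rewrite next_at_left_turn.
case: (next_is_arc cxa) => sxa; last by rewrite b_arc_entry in nEl.
have cxaa : x * a * a \in c by rewrite -sxa mem_next.
right; case: (next_is_arc cxaa) => sxaa; last by rewrite b_arc_entry.
by case: (@next_aperiodic 3 x cx isT); rewrite /= sx sxa sxaa mulaaa.
Qed.

Definition turns_right x := x * a * b \notin E.

(** The first-return map of the cycle to its entries, that is, the successor map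
    of the cycle obtained by contracting the triangles. *)
Definition next_entry x := if turns_right x then x * a * a * b else x * a * b.
Local Notation t := next_entry.

Lemma next_entry_in x : x \in E -> t x \in E.
Proof.
move=> Ex; rewrite /t /turns_right.
by case: (entry_turn Ex) => [[El _]|[nEl Er _ _]]; rewrite ?El ?nEl.
Qed.

Lemma next_entry_iter x : x \in E -> t x = iter (2 + turns_right x) s x.
Proof.
move=> Ex; have [_ _ _ sx] := entryP Ex; rewrite /t /turns_right.
case: (entry_turn Ex) => [[-> sl]|[-> _ sa saa]] /=; first by rewrite sx sl.
by rewrite sx sa saa.
Qed.

Lemma iter_next_entry_in n x : x \in E -> iter n t x \in E.
Proof. by move=> Ex; elim: n => //= n; exact: next_entry_in. Qed.

Lemma iter_next_entry n x : x \in E ->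
  exists2 k, n <= k <= 3 * n & iter n t x = iter k s x.
Proof.
move=> Ex; elim: n => [|n [k /andP[le_n le_k] eq_k]]; first by exists 0.
exists (2 + turns_right (iter n t x) + k).
  by case: turns_right; lia.
by rewrite iterS next_entry_iter ?iter_next_entry_in // [RHS]iterD -eq_k.
Qed.

Lemma next_entry_aperiodic n x : x \in E -> 0 < n <= 10 -> iter n t x <> x.
Proof.
move=> Ex /andP[n_gt0 n_le].
have [k /andP[le_n le_k] ->] := iter_next_entry n Ex.
have [cx _ _ _] := entryP Ex; apply: next_aperiodic => //; lia.
Qed.

Lemma next_entry_inj : {in E &, injective t}.
Proof.
have two_three x y : x \in E -> y \in E -> iter 2 s x <> iter 3 s y.
  (* An entry is not the successor of an entry: the former is reached along a
     b-arc, the latter is left along an a-arc. *)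
  move=> Ex Ey; rewrite iterSr => /next_injective/next_injective x_eq.
  have [_ _ sxb _] := entryP Ex; have [cy _ _ sy] := entryP Ey.
  move: sxb; rewrite {2}x_eq => /next_injective xb_y.
  case/eqP: a_neq_b; apply: (mulgI y).
  by rewrite -sy -x_eq -xb_y mulbb.
move=> x y Ex Ey; rewrite !next_entry_iter //.
case: (turns_right x); case: (turns_right y) => //=.
- by do 3!move/next_injective.
- by move/esym/two_three => /(_ Ey Ex).
- by move/two_three => /(_ Ex Ey).
- by do 2!move/next_injective.
Qed.

(** The vertex xaa could only be reached from xa, which is left towards xab, or
    from xaab; in the latter case it would be an entry, with successor x, but
    the predecessor of x is xb. *)
Lemma left_turn_misses x : x \in E -> ~~ turns_right x -> x * a * a \notin c.
Proof.
rewrite negbK => Ex El; have sl := next_at_left_turn El.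
have [_ _ sxb _] := entryP Ex.
apply/negP=> cxaa; set z := prev c (x * a * a).
have sz : s z = x * a * a by rewrite /z next_prev.
have cz : z \in c by rewrite mem_prev.
case: (next_is_arc cz) => sz'; rewrite sz in sz'.
  have /mulIg xa_z := sz'; case/eqP: a_neq_b; apply: (mulgI (x * a)).
  by rewrite -sl xa_z sz.
have [_ _ _] := entryP (b_arc_entry cz (etrans sz sz')).
rewrite -sz' mulaaa => sxaa; case/eqP: a2_neq_b; apply: (mulgI x).
by apply: next_injective; rewrite sxb mulgA.
Qed.

(** If the right exit of the triangle of an entry x is an entry, then it is the
    one that follows x.  So a cycle about to surround one or two faces does
    close up, since the place where it started is an entry. *)
Lemma right_exit_turn x : x \in E -> x * a * a * b \in E -> turns_right x.
Proof.
move=> Ex /entryP[_ cxaa _ _]; apply: contraLR cxaa => nR.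
by rewrite mulbb left_turn_misses.
Qed.

Lemma next_entry_right x :
  x \in E -> x * a * a * b \in E -> t x = x * a * a * b.
Proof. by move=> Ex Er; rewrite /t right_exit_turn. Qed.

Lemma no_five_rights x : x \in E -> itinerary t turns_right 5 x != nseq 5 true.
Proof.
move=> Ex; apply/eqP; rewrite /itinerary /= => -[R0 R1 R2 R3 R4].
apply: (@next_entry_aperiodic 6 x) => //.
have y_eq : iter 5 t x = iter 5 (fun y => y * a * a * b) x.
  by rewrite /= {1}/t R4 {1}/t R3 {1}/t R2 {1}/t R1 {1}/t R0.
have yr : iter 5 t x * a * a * b = x by rewrite y_eq -[RHS]mul_r6.
by rewrite iterS (@next_entry_right (iter 5 t x)) ?yr ?iter_next_entry_in.
Qed.

Lemma no_three_left_four x : x \in E ->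
  itinerary t turns_right 8 x != nseq 3 true ++ false :: nseq 4 true.
Proof.
move=> Ex; apply/eqP; rewrite /itinerary /= => -[R0 R1 R2 R3 R4 R5 R6 R7].
(* Eight turns stop short of the ninth vertex around the two hexagons; the turn
   there is to the left because a run of five right turns is impossible. *)
have R8 : turns_right (iter 8 t x) = false.
  have := no_five_rights (iter_next_entry_in 4 Ex).
  by rewrite /itinerary /= R4 R5 R6 R7; case: turns_right.
apply: (@next_entry_aperiodic 10 x) => //.
have yr : iter 9 t x * a * a * b = x.
  rewrite -[RHS]mul_r3lr4lr iterS {1}/t R8 /= {1}/t R7 {1}/t R6 {1}/t R5.
  by rewrite {1}/t R4 {1}/t R3 {1}/t R2 {1}/t R1 {1}/t R0.
by rewrite iterS (@next_entry_right (iter 9 t x)) ?yr ?iter_next_entry_in.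
Qed.

(** Three consecutive a-arcs close a triangle, so going back along the cycle an
    entry is met after at most two a-arcs. *)
Lemma cycle_sub_entries :
  [set x in c] \subset E :|: [set x * a | x in E]
                  :|: [set x * a * a | x in [set x in E | turns_right x]].
Proof.
have pred_in y : y \in c -> exists2 z, z \in c & s z = y.
  by move=> cy; exists (prev c y); rewrite ?mem_prev ?next_prev.
have from_a y : y \in c ->
    y \in E \/ exists z, [/\ z \in c, s z = y & y = z * a].
  move=> cy; have [z cz sz] := pred_in y cy.
  case: (next_is_arc cz) => sz'; last by left; rewrite -sz sz' b_arc_entry.
  by right; exists z; rewrite -sz'.
apply/subsetP=> y; rewrite inE => cy; rewrite 2!in_setU -orbA.
case: (from_a y cy) => [Ey | [z [cz sz y_eq]]].
  by rewrite Ey.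
case: (from_a z cz) => [Ez | [w [cw sw z_eq]]].
  by rewrite y_eq (imset_f (fun x => x * a)) ?orbT.
case: (from_a w cw) => [Ew | [v [cv sv w_eq]]]; last first.
  case: (@next_aperiodic 3 v cv isT).
  by rewrite /= sv sw sz y_eq z_eq w_eq mulaaa.
rewrite y_eq z_eq (imset_f (fun x => x * a * a)) ?orbT // inE Ew /=.
apply/negP=> El; case/eqP: a_neq_b; apply: (mulgI (w * a)).
by rewrite -(next_at_left_turn El) -z_eq -y_eq.
Qed.

Lemma long_cycle_size : 12 * size c <= 11 * #|gT|.
Proof.
set Rs := [set x in E | turns_right x].
set Ls := [set x in E | ~~ turns_right x].
have le_RL : #|Rs| <= 3 * #|Ls|.
  apply: card_rights_le; [exact: next_entry_in | exact: next_entry_inj | | ].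
    exact: no_five_rights.
  exact: no_three_left_four.
have card_E : #|E| = #|Rs| + #|Ls|.
  rewrite -(cardsID [set x | turns_right x] E).
  by congr (_ + _); apply: eq_card => x; rewrite !inE // andbC.
have card_c : size c = #|[set x in c]| by rewrite cardsE (card_uniqP c_uniq).
have le_c : size c <= #|E| + #|E| + #|Rs|.
  rewrite card_c (leq_trans (subset_leq_card cycle_sub_entries)) //.
  rewrite (leq_trans (leq_card_setU _ _)) // leq_add ?leq_imset_card //.
  by rewrite (leq_trans (leq_card_setU _ _)) // leq_add ?leq_imset_card.
have le_L : #|Ls| + size c <= #|gT|.
  have aa_inj : injective (fun x => x * a * a) by move=> x y /mulIg/mulIg.
  rewrite -(card_imset _ aa_inj) -(cardsC [set x in c]) -card_c addnC.
  rewrite leq_add2l subset_leq_card //; apply/subsetP=> _ /imsetP[x Lx ->].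
  by move: Lx; rewrite inE => /andP[Ex Lx]; rewrite !inE left_turn_misses.
lia.
Qed.

End LongCycle.

(** * Cayley digraphs *)

Section CayleyDigraph.
Variables (gT : finGroupType) (a b : gT).
Hypotheses (a_neq1 : a != 1%g) (b_neq1 : b != 1%g).
Open Scope group_scope.

Lemma cayley_arc_irrefl : irreflexive (cayley_arc a b).
Proof.
move=> x; have neq_mul z : z != 1 -> (x == x * z) = false.
  by rewrite -{1}[x]mulg1 (inj_eq (mulgI x)) eq_sym => /negPf.
by rewrite /cayley_arc /= !neq_mul.
Qed.

Definition cayley_digraph := Digraph cayley_arc_irrefl.

Lemma cayley_vertex_transitive : vertex_transitive cayley_digraph.
Proof.
move=> u v; exists (perm (mulgI (v * u^-1))); last by rewrite permE mulgKV.
apply/forallP=> x; apply/forallP=> y; rewrite /= !permE /=.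
by rewrite /cayley_arc /= -!mulgA !(inj_eq (mulgI _)).
Qed.

Lemma cayley_connected :
  <<[set a; b]>> = [set: gT] -> connected_digraph cayley_digraph.
Proof.
move=> gen u v.
have : u^-1 * v \in <<[set a; b]>> by rewrite gen inE.
case/gen_prodgP=> n [g g_ab uv].
have -> : v = u * \prod_i g i by rewrite -uv mulKVg.
elim: n g g_ab {uv} => [|n IHn] g g_ab.
  by rewrite big_ord0 mulg1 connect0.
rewrite big_ord_recr mulgA /=.
have := IHn _ (fun i => g_ab (widen_ord (leqnSn n) i)).
move/connect_trans; apply; apply: connect1.
rewrite /underlying_adj /= /cayley_arc /=.
by case/set2P: (g_ab ord_max) => ->; rewrite eqxx ?orbT.
Qed.

(** The bound 33 ensures that cycles of length at most 30, to which
    [long_cycle_size] does not apply, have at most 11/12 of the vertices. *)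
Lemma cayley_perimeter_gap :
    a ^+ 3 = 1 -> b ^+ 2 = 1 -> (a * a * b) ^+ 6 = 1 -> 33 <= #|gT| ->
  #|gT| <= 12 * perimeter_gap cayley_digraph.
Proof.
move=> a3 b2 r6 gT_large.
rewrite -[#|gT|]/#|vertex cayley_digraph| in gT_large *; rewrite /perimeter_gap.
suff: longest_cycle_length cayley_digraph <=
    11 * #|vertex cayley_digraph| %/ 12 by lia.
apply/bigmax_leqP => k /existsP[c /and3P[_ c_cycle c_uniq]].
have long : 30 < k -> 12 * k <= 11 * #|vertex cayley_digraph|.
  rewrite -(size_tuple c) => k_gt.
  exact: (long_cycle_size a_neq1 a3 b2 r6 c_cycle c_uniq k_gt).
by have [k_le | /long] := leqP k 30; lia.
Qed.

End CayleyDigraph.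

(** * Rotations of a torus *)

Section Rotations.
Import GRing.Theory.
Variable m : nat.
Local Notation Z := 'Z_m.+2.
Open Scope ring_scope.

(** In the basis 1, w of the Eisenstein lattice, reduced modulo an integer, this
    is multiplication by the primitive cube root of unity w: it sends x + y w to
    x w + y w w = - y + (x - y) w. *)
Definition rot3_fun (p : Z * Z) : Z * Z := (- p.2, p.1 - p.2).

(** A half-turn with another centre: with the same centre as [rot3_fun], the two
    rotations would generate a group of order at most six. *)
Definition rot2_fun (p : Z * Z) : Z * Z := (1 - p.1, - p.2).

Lemma rot3_fun_inj : injective rot3_fun.
Proof.
apply: (can_inj (g := fun p => (p.2 - p.1, - p.1))) => -[x y].
by congr (_, _); rewrite /=; ring.
Qed.

Lemma rot2_fun_inj : injective rot2_fun.
Proof.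
apply: (can_inj (g := rot2_fun)) => -[x y].
by congr (_, _); rewrite /=; ring.
Qed.

Definition rot3 := perm rot3_fun_inj.
Definition rot2 := perm rot2_fun_inj.

Let rotE := (permM, permE, perm1).

Lemma rot3_order : (rot3 ^+ 3 = 1)%g.
Proof.
apply/permP=> -[x y]; rewrite !expgS expg0 !rotE /rot3_fun /=.
by congr (_, _); ring.
Qed.

Lemma rot2_order : (rot2 ^+ 2 = 1)%g.
Proof.
apply/permP=> -[x y]; rewrite !expgS expg0 !rotE /rot2_fun /=.
by congr (_, _); ring.
Qed.

(* Composed with the rotation by two thirds of a turn, the half-turn gives a
   rotation by a sixth of a turn. *)
Lemma rot6E p : (rot3 * rot3 * rot2)%g p = (1 + p.1 - p.2, p.1).
Proof.
by rewrite !rotE /rot2_fun /rot3_fun /=; congr (_, _); ring.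
Qed.

Lemma rot6_cubeE p :
  ((rot3 * rot3 * rot2) ^+ 3)%g p = (1 + 1 - p.1, 1 + 1 - p.2).
Proof.
rewrite !expgS expg0 mulg1 !(permM _ (_ * _)%g) !rot6E /=.
by congr (_, _); ring.
Qed.

Lemma rot6_order : ((rot3 * rot3 * rot2) ^+ 6 = 1)%g.
Proof.
apply/permP=> -[x y]; rewrite (expgD _ 3 3) permM !rot6_cubeE perm1 /=.
by congr (_, _); ring.
Qed.

(** The product of two half-turns is a translation, here by (1, 2). *)
Lemma translation_iter k :
  ((rot2 * (rot3 * rot3 * rot2) ^+ 3) ^+ k)%g (0, 0) = (k%:R, k%:R *+ 2).
Proof.
elim: k => [|k IHk]; first by rewrite expg0 perm1 mul0rn.
rewrite expgSr permM IHk permM rot6_cubeE permE /=.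
by congr (_, _); ring.
Qed.

Lemma translation_order :
  (m.+2 <= #[rot2 * (rot3 * rot3 * rot2) ^+ 3]%g)%N.
Proof.
set t := (rot2 * _)%g; apply: dvdn_leq; first exact: order_gt0.
have := translation_iter #[t]%g; rewrite -/t expg_order perm1 => -[/esym/eqP].
rewrite -Zp_nat_mod // => /eqP/(congr1 val) /=.
by rewrite Zp_nat /= modn_mod => /eqP.
Qed.

Lemma rot3_neq1 : rot3 != 1%g.
Proof.
apply/eqP=> /permP/(_ (0, 1)); rewrite !rotE => /(congr1 fst)/eqP.
by rewrite /= oppr_eq0 oner_eq0.
Qed.

Lemma rot2_neq1 : rot2 != 1%g.
Proof.
apply/eqP=> /permP/(_ (0, 0)); rewrite !rotE => /(congr1 fst)/eqP.
by rewrite /= subr0 oner_eq0.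
Qed.

End Rotations.

Lemma rotation_group_exists N : exists (gT : finGroupType) (a b : gT),
  [/\ (N <= #|gT|)%N, <<[set a; b]>>%g = [set: gT], a != 1%g /\ b != 1%g &
      [/\ (a ^+ 3 = 1)%g, (b ^+ 2 = 1)%g & ((a * a * b) ^+ 6 = 1)%g]].
Proof.
(* The rotations generate a subgroup of the permutations of the torus, which has
   to be turned into a group type of its own. *)
pose A := [set rot3 N; rot2 N]; pose G := <<A>>%G.
have Ga : rot3 N \in G by rewrite mem_gen ?set21.
have Gb : rot2 N \in G by rewrite mem_gen ?set22.
exists (subg_of G), (subg G (rot3 N)), (subg G (rot2 N)); split.
- have card_G : #|subg_of G| = #|G|.
    by rewrite -cardsT -im_subg card_injm ?injm_subg.
  rewrite card_G; apply: leq_trans (ltnW (ltnW (translation_order N))) _.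
  by apply: subset_leq_card; rewrite cycle_subG !(groupM, groupX).
- rewrite -im_subg [RHS]morphim_gen ?subset_gen //.
  by rewrite morphimU !morphim_set1.
- by split; rewrite -(inj_eq subg_inj) subgK ?rot3_neq1 ?rot2_neq1.
- rewrite -!morphM ?groupM // -!morphX ?groupM //.
  by rewrite rot3_order rot2_order rot6_order !morph1.
Qed.

Import Order.TTheory GRing.Theory Num.Theory.
Local Open Scope ring_scope.

Theorem theorem1p3 :
  forall N : nat, exists n : nat, (N <= n)%N /\
    exists D : digraph,
      [/\ #|vertex D| = n,
          connected_digraph D,
          vertex_transitive D
        & (n%:R / 12%:R : rat) <= (perimeter_gap D)%:R].
Proof.
move=> N.
have [gT [a [b [gT_large gen [a1 b1] [a3 b2 r6]]]]] :=
  rotation_group_exists (maxn N 33).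
exists #|gT|; split; first by rewrite (leq_trans _ gT_large) ?leq_maxl.
exists (cayley_digraph a1 b1); split=> //.
- exact: cayley_connected.
- exact: cayley_vertex_transitive.
rewrite ler_pdivrMr ?ltr0n // -natrM ler_nat mulnC.
by rewrite cayley_perimeter_gap // (leq_trans _ gT_large) ?leq_maxr.
Qed.
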